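(* There exist an integer $n\ge 1$, a matrix $A=[a_{i,j}]\in\mathcal{H}_n$, and a matrix $B=[b_{i,j}]\in\mathcal{H}_n$ with nonnegative entries ($b_{i,j}\ge 0$ for all $i,j$) such that $$\operatorname{per}(A\circ B)> \operatorname{per}(A)\prod_{i=1}^n b_{i,i}.$$ That is, the nonnegativity of the entries of $B\in\mathcal{H}_n$ is not sufficient to ensure that $\operatorname{per}(A\circ B)\le\operatorname{per}(A)\prod_{i=1}^n b_{i,i}$ holds for all $A\in\mathcal{H}_n$.
   Context: $\mathcal{H}_n$ denotes the set of $n\times n$ positive semidefinite Hermitian (complex) matrices. The permanent of an $n\times n$ matrix $A=[a_{i,j}]$ is $\operatorname{per}(A)=\sum_{\sigma\in S_n}\prod_{i=1}^n a_{i,\sigma(i)}$ (it is a nonnegative real number when $A\in\mathcal{H}_n$). $A\circ B=[a_{i,j}b_{i,j}]$ is the Hadamard (entrywise) product. *)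

(* Defs.v *)
From HB Require Import structures.
From mathcomp Require Import all_boot all_order all_fingroup all_algebra.
From mathcomp Require Import reals complex.

Set Implicit Arguments.
Unset Strict Implicit.
Unset Printing Implicit Defensive.

Import Order.TTheory GRing.Theory Num.Theory.
Local Open Scope ring_scope.
Local Open Scope sesquilinear_scope.

Definition per (K : comNzRingType) (n : nat) (A : 'M[K]_n) : K :=
  \sum_(s : 'S_n) \prod_(i < n) A i (s i).

Definition hadamard (K : comNzRingType) (n : nat) (A B : 'M[K]_n) : 'M[K]_n :=
  map2_mx *%R A B.

(* In the partial order of R[i], x <= y (resp. x < y) means that x and y have
   the same imaginary part and Re x <= Re y (resp. Re x < Re y); in particular
   0 <= z says that z is a nonnegative real number. *)
Definition psd_hermitian (R : realType) (n : nat) (A : 'M[R[i]]_n) : Prop :=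
  A \is hermsymmx /\ forall x : 'cV[R[i]]_n, 0 <= (x ^t* *m A *m x) 0 0.

(* Main.v *)
From Stdlib Require Import ZArith.
Require Import Defs.
From HB Require Import structures.
From mathcomp Require Import all_boot all_order all_fingroup all_algebra.
From mathcomp Require Import reals complex mpoly ssrZ ring.

(** The theorem is proved by exhibiting one pair of 16 by 16 Gram matrices over
    the Gaussian integers.  The matrix A is the Gram matrix of sixteen vectors
    of C^2, and B that of the sixteen vectors (3, x_i) of R^2, where x_i is an
    integer with |x_i| <= 3; thus b_ij = 9 + x_i x_j >= 0, and both matrices are
    positive semidefinite.  The Hadamard product of the two is the Gram matrix
    of the tensor products of the vectors, which lie in C^4
    ([hadamard_gram]).  The three numbers to compare are then
      - per A                = 2453939712000,
      - the product of b_ii  = 465593334336000000,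
      - per (A o B)          = 1261195342228823138813713121280,
    and the last exceeds the product of the first two by about ten per cent.

    A permanent of order 16 has 16! terms, but a matrix of small rank r has a
    cheap permanent.  If M = U W^T with U and W of size n by r, the rows of W
    are read as linear forms l_1, ..., l_n in r variables and the rows of U as
    constant vector fields D_1, ..., D_n on r-space; then D_i l_j = m_ij, and
    the Leibniz rule applied to D_i (l_1 ... l_n) is the expansion of the
    permanent along row i.  Hence
      D_1 ... D_n (l_1 ... l_n) = per M            ([per_dir_deriv]).
    For r = 4 and n = 16 the intermediate forms have at most 969 coefficients,
    so the left-hand side is obtained by computing with sparse lists of terms
    whose coefficients are pairs of binary integers; [gram_perE] transports the
    result of that computation to the permanent over the complex numbers. *)

Set Implicit Arguments.
Unset Strict Implicit.
Unset Printing Implicit Defensive.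

Import Order.TTheory GRing.Theory Num.Theory.
Local Open Scope ring_scope.
Local Open Scope sesquilinear_scope.

(** * The permanent of a matrix of given rank *)

(** The permutations sending [ord0] to [j] are exactly the [lift_perm ord0 j t],
    with [t] a permutation of one element less. *)
Lemma per_expand_row (K : comNzRingType) (n : nat) (A : 'M[K]_n.+1) :
  per A = \sum_j A ord0 j * per (row' ord0 (col' j A)).
Proof.
rewrite /per (partition_big (fun s : 'S_n.+1 => s ord0) xpredT) //=.
apply: eq_bigr => j _; rewrite (reindex (lift_perm ord0 j)); last first.
  (* [unlifted i s] is the permutation s with i removed from its source and
     s i from its target. *)
  pose unlifted i (s : 'S_n.+1) k := odflt k (unlift (s i) (s (lift i k))).
  have unliftedK i (s : 'S_n.+1) k : lift (s i) (unlifted i s k) = s (lift i k).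
    rewrite /unlifted; have := neq_lift i k.
    by rewrite -(can_eq (permK s)) => /unlift_some[] ? ? ->.
  have unlifted_inj : injective (unlifted ord0 _).
    move=> s; apply: can_inj (unlifted (s ord0) s^-1%g) _ => k'.
    by rewrite {1}/unlifted unliftedK !permK liftK.
  exists (fun s => perm (unlifted_inj s)) => [s _ | s].
    by apply/permP => k'; rewrite permE /unlifted lift_perm_lift lift_perm_id liftK.
  move/(s _ =P _) => s0; apply/permP => k.
  case: (unliftP ord0 k) => [k'|] ->; rewrite ?lift_perm_id //.
  by rewrite lift_perm_lift -s0 permE unliftedK.
rewrite big_distrr /=; apply: eq_big => [s | s _].
  by rewrite lift_perm_id eqxx.
rewrite big_ord_recl lift_perm_id; congr (_ * _).
by apply: eq_bigr => i _; rewrite !mxE lift_perm_lift.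
Qed.

Section DirectionalDerivative.
Variables (K : comNzRingType) (r : nat).

Definition dir_deriv (u : 'rV[K]_r) (p : {mpoly K[r]}) : {mpoly K[r]} :=
  \sum_(k < r) u 0 k *: p^`M(k).

Definition linear_form (w : 'rV[K]_r) : {mpoly K[r]} :=
  \sum_(k < r) w 0 k *: 'X_k.

Lemma dir_deriv_sumZ (I : finType) u (c : I -> K) (F : I -> {mpoly K[r]}) :
  dir_deriv u (\sum_i c i *: F i) = \sum_i c i *: dir_deriv u (F i).
Proof.
rewrite /dir_deriv; under [RHS]eq_bigr => i _ do rewrite scaler_sumr.
rewrite exchange_big; apply: eq_bigr => k _.
rewrite (raddf_sum (mderiv k)) scaler_sumr; apply: eq_bigr => i _.
by rewrite /= mderivZ !scalerA mulrC.
Qed.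

Lemma foldl_dir_deriv_sumZ (I : finType) (us : seq 'rV[K]_r) (c : I -> K)
    (F : I -> {mpoly K[r]}) :
  foldl (fun p u => dir_deriv u p) (\sum_i c i *: F i) us =
    \sum_i c i *: foldl (fun p u => dir_deriv u p) (F i) us.
Proof. by elim: us F => //= u us IHus F; rewrite dir_deriv_sumZ IHus. Qed.

Lemma dir_derivM u p q :
  dir_deriv u (p * q) = dir_deriv u p * q + p * dir_deriv u q.
Proof.
rewrite /dir_deriv mulr_suml mulr_sumr -big_split /=; apply: eq_bigr => k _.
by rewrite mderivM scalerDr -scalerAl -scalerAr.
Qed.

Lemma dir_deriv_linear_form u w :
  dir_deriv u (linear_form w) = ((u *m w^T) 0 0)%:MP.
Proof.
have mderivXU k i : mderiv k 'X_i = (i == k)%:R :> {mpoly K[r]}.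
  rewrite mderivX mnm1E; case: eqP => [-> | _]; last by rewrite scale0r.
  by rewrite scale1r -{1}[U_(k)%MM]add0m addmK mpolyX0.
rewrite mxE rmorph_sum /=; apply: eq_bigr => k _.
rewrite (raddf_sum (mderiv k)) (bigD1 k) //= big1 => [|i /negPf ik].
  by rewrite /= mderivZ mderivXU eqxx addr0 mxE scalerA alg_mpolyC.
by rewrite /= mderivZ mderivXU ik scaler0.
Qed.

Lemma dir_deriv_prod u n (f : 'I_n.+1 -> {mpoly K[r]}) :
  dir_deriv u (\prod_j f j) =
    \sum_j dir_deriv u (f j) * \prod_(k < n) f (lift j k).
Proof.
elim: n f => [|n IHn] f; first by rewrite !big_ord1 big_ord0 mulr1.
rewrite big_ord_recl dir_derivM IHn mulr_sumr [RHS]big_ord_recl.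
congr (_ + _); apply: eq_bigr => j _.
rewrite mulrCA big_ord_recl; congr (_ * (f _ * _)); first exact: val_inj.
apply: eq_bigr => k _; congr (f _); apply: val_inj; rewrite /= /bump.
by rewrite !add1n ltnS; case: leq.
Qed.

(** Differentiating the product of the forms along row 0 of [U] replaces each
    form in turn by an entry of row 0 of [U *m W^T]; what remains in the j-th
    summand is the same expression for [U] without row 0 and [W] without row j,
    so this is the row expansion of the permanent. *)
Theorem per_dir_deriv n (U W : 'M[K]_(n, r)) :
  foldl (fun p u => dir_deriv u p) (\prod_j linear_form (row j W))
    [seq row i U | i <- enum 'I_n] = (per (U *m W^T))%:MP.
Proof.
elim: n U W => [|n IHn] U W.
  rewrite big_ord0 (size0nil (size_enum_ord 0)) /per /=.
  rewrite (big_pred1 1%g) ?big_ord0 // => s.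
  by apply/esym/eqP/permP => -[].
rewrite enum_ordSl /= dir_deriv_prod.
under eq_bigr => j _ do rewrite dir_deriv_linear_form mul_mpolyC.
rewrite foldl_dir_deriv_sumZ per_expand_row rmorph_sum.
apply: eq_bigr => j _; rewrite rmorphM /= mul_mpolyC.
congr (_ *: _).
  by rewrite !mxE; apply: eq_bigr => k _; rewrite !mxE.
rewrite -map_comp.
have -> : row' ord0 (col' j (U *m W^T)) = row' ord0 U *m (row' j W)^T.
  by apply/matrixP => a b; rewrite !mxE; apply: eq_bigr => k _; rewrite !mxE.
rewrite -IHn; congr foldl.
  by apply: eq_bigr => k _; congr linear_form; apply/rowP => a; rewrite !mxE.
by apply: eq_map => i /=; apply/rowP => a; rewrite !mxE.
Qed.

End DirectionalDerivative.

(** * Gaussian integers with binary components *)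

Definition gauss : Type := (Z * Z)%type.
Definition gauss0 : gauss := (Z0, Z0).
Definition gauss1 : gauss := (Zpos xH, Z0).

Definition gauss_add (x y : gauss) : gauss := (Z.add x.1 y.1, Z.add x.2 y.2).

Definition gauss_mul (x y : gauss) : gauss :=
  (Z.sub (Z.mul x.1 y.1) (Z.mul x.2 y.2), Z.add (Z.mul x.1 y.2) (Z.mul x.2 y.1)).

Definition gauss_muln (k : nat) (x : gauss) : gauss :=
  (Z.mul (Z.of_nat k) x.1, Z.mul (Z.of_nat k) x.2).

Definition gauss_conj (x : gauss) : gauss := (x.1, Z.opp x.2).

Definition gauss_ge0 (x : gauss) : bool := Z.leb Z0 x.1 && Z.eqb x.2 Z0.

Section GaussEmbedding.
Variable R : realType.

Definition real_of_Z (z : Z) : R := (int_of_Z z)%:~R.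

Definition complex_of_gauss (x : gauss) : R[i] :=
  Complex (real_of_Z x.1) (real_of_Z x.2).

Local Notation phi := complex_of_gauss.

Lemma real_of_ZD : {morph real_of_Z : x y / Z.add x y >-> x + y}.
Proof. by move=> x y; rewrite /real_of_Z -intrD -(rmorphD int_of_Z). Qed.

Lemma real_of_ZM : {morph real_of_Z : x y / Z.mul x y >-> x * y}.
Proof. by move=> x y; rewrite /real_of_Z -intrM -(rmorphM int_of_Z). Qed.

Lemma real_of_ZN : {morph real_of_Z : x / Z.opp x >-> - x}.
Proof. by move=> x; rewrite /real_of_Z -mulrNz -(rmorphN int_of_Z). Qed.

Lemma real_of_Z_nat k : real_of_Z (Z.of_nat k) = k%:R.
Proof.
rewrite /real_of_Z; have -> : int_of_Z (Z.of_nat k) = k%:Z; last exact: pmulrn.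
by apply: (can_inj Z_of_intK); rewrite int_of_ZK.
Qed.

Lemma real_of_Z_ge0 z : Z.leb Z0 z -> 0 <= real_of_Z z.
Proof. by case: z => // p _; rewrite /real_of_Z ler0z. Qed.

Lemma real_of_Z_lt x y : Z.lt x y -> real_of_Z x < real_of_Z y.
Proof.
move=> /Z.lt_0_sub; rewrite -subr_gt0 -real_of_ZN -real_of_ZD /Z.sub.
case: (Z.add _ _) => // p _; rewrite /real_of_Z ltr0z /= ltz_nat.
by apply/ssrnat.ltP/Pos2Nat.is_pos.
Qed.

Lemma complex_of_gauss0 : phi gauss0 = 0. Proof. by []. Qed.

Lemma complex_of_gauss1 : phi gauss1 = 1. Proof. by []. Qed.

Lemma complex_of_gaussD : {morph phi : x y / gauss_add x y >-> x + y}.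
Proof. by move=> x y; rewrite /phi !real_of_ZD. Qed.

Lemma complex_of_gaussM : {morph phi : x y / gauss_mul x y >-> x * y}.
Proof.
move=> x y.
by rewrite /phi real_of_ZD /Z.sub real_of_ZD real_of_ZN !real_of_ZM.
Qed.

Lemma complex_of_gaussMn k : {morph phi : x / gauss_muln k x >-> k%:R * x}.
Proof.
move=> x; rewrite /phi !real_of_ZM real_of_Z_nat -(rmorph_nat (real_complex R)).
by apply/eqP; rewrite eq_complex /= !mul0r subr0 addr0 !eqxx.
Qed.

Lemma complex_of_gauss_conj x : phi (gauss_conj x) = (phi x)^*.
Proof. by rewrite /phi real_of_ZN. Qed.

Lemma complex_of_gauss_ge0 x : gauss_ge0 x -> 0 <= phi x.
Proof.
case: x => a b /andP[/= a0 /Z.eqb_eq ->].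
by rewrite lecE /= eqxx real_of_Z_ge0.
Qed.

Lemma complex_of_gauss_lt x y : Z.lt x y -> phi (x, Z0) < phi (y, Z0).
Proof. by move=> xy; rewrite ltcE /= eqxx real_of_Z_lt. Qed.

End GaussEmbedding.

(** * Sparse computation with homogeneous forms *)

Definition term : Type := (seq nat * gauss)%type.

Fixpoint lexico (e f : seq nat) : bool :=
  match e, f with
  | x :: e', y :: f' => if x == y then lexico e' f' else (x < y)%N
  | _, _ => false
  end.

(** Merging lexicographically sorted lists collects all like terms, which bounds
    the length of the result by the number of monomials of the given degree. *)
Fixpoint terms_add (p q : seq term) {struct p} : seq term :=
  if p is (e, a) :: p' then
    (fix merge_p (q : seq term) : seq term :=
       if q is (f, b) :: q' then
         if e == f then (e, gauss_add a b) :: terms_add p' q'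
         else if lexico e f then (e, a) :: terms_add p' q
         else (f, b) :: merge_p q'
       else p) q
  else q.

Definition terms_mulX (k : nat) (c : gauss) (p : seq term) : seq term :=
  [seq (incr_nth t.1 k, gauss_mul c t.2) | t <- p].

(** Terms free of the k-th variable are dropped, and not kept with coefficient
    0: lowering their exponent by the truncated predecessor would break the
    order of the list. *)
Definition terms_deriv (k : nat) (c : gauss) (p : seq term) : seq term :=
  [seq (set_nth 0%N t.1 k (nth 0%N t.1 k).-1,
        gauss_mul c (gauss_muln (nth 0%N t.1 k) t.2))
     | t <- p & nth 0%N t.1 k != 0%N].

Definition terms_comb (op : nat -> gauss -> seq term -> seq term) (r : nat)
    (v : seq gauss) (p : seq term) : seq term :=
  foldr terms_add [::] [seq op k (nth gauss0 v k) p | k <- iota 0 r].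

(** The left-hand side of [per_dir_deriv] when the rows of [U] are the vectors
    of [V] and those of [W] their conjugates, so that [U *m W^T] is a Gram
    matrix. *)
Definition gram_per (r : nat) (V : seq (seq gauss)) : seq term :=
  foldl (fun p v => terms_comb terms_deriv r v p)
    (foldr (terms_comb terms_mulX r) [:: (nseq r 0%N, gauss1)]
           [seq map gauss_conj v | v <- V]) V.

Definition gauss_dot (r : nat) (u v : seq gauss) : gauss :=
  foldr gauss_add gauss0
    [seq gauss_mul (nth gauss0 u k) (gauss_conj (nth gauss0 v k)) | k <- iota 0 r].

Section Evaluation.
Variables (R : realType) (r : nat).
Local Notation phi := (complex_of_gauss R).

Definition monom (e : seq nat) : 'X_{1..r} := [multinom nth 0%N e k | k < r].

Definition terms_eval (p : seq term) : {mpoly R[i][r]} :=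
  \sum_(t <- p) phi t.2 *: 'X_[monom t.1].

Definition gauss_row (v : seq gauss) : 'rV[R[i]]_r :=
  \row_k phi (nth gauss0 v k).

Lemma terms_eval_add p q :
  terms_eval (terms_add p q) = terms_eval p + terms_eval q.
Proof.
rewrite /terms_eval.
elim: p q => [|[e a] p IHp] q /=; first by rewrite big_nil add0r.
elim: q => [|[f b] q IHq] /=; first by rewrite big_nil addr0.
case: eqP => [<-|_].
  by rewrite !big_cons IHp complex_of_gaussD scalerDl addrACA.
case: ifP => _; rewrite !big_cons; first by rewrite IHp big_cons addrA.
by rewrite IHq big_cons addrCA.
Qed.

Lemma terms_eval_mulX (k : 'I_r) c p :
  terms_eval (terms_mulX k c p) = phi c *: 'X_k * terms_eval p.
Proof.
rewrite /terms_eval big_map mulr_sumr; apply: eq_bigr => -[e a] _ /=.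
rewrite complex_of_gaussM -scalerAl -scalerAr scalerA; congr (_ *: _).
rewrite -mpolyXD; congr 'X_[_]; apply/mnmP => i.
by rewrite mnmDE mnm1E !mnmE nth_incr_nth.
Qed.

Lemma terms_eval_deriv (k : 'I_r) c p :
  terms_eval (terms_deriv k c p) = phi c *: (terms_eval p)^`M(k).
Proof.
rewrite /terms_eval big_map big_filter (raddf_sum (mderiv k)) scaler_sumr.
rewrite [RHS](bigID (fun t : term => nth 0%N t.1 k != 0%N)) /=.
rewrite [X in _ = _ + X]big1 ?addr0.
  apply: eq_bigr => -[e a] _ /=.
  rewrite mderivZ mderivX complex_of_gaussM complex_of_gaussMn !scalerA mnmE.
  rewrite [_%:R * _]mulrC ?mulrA.
  congr (_ *: 'X_[_]); apply/mnmP => i.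
  rewrite mnmBE mnm1E !mnmE nth_set_nth /= -val_eqE /= [k == i :> nat]eq_sym.
  by case: eqP => [->|_]; rewrite ?subn1 ?subn0.
move=> [e a] /= /negPn /eqP e0.
by rewrite mderivZ mderivX mnmE e0 scale0r !scaler0.
Qed.

Lemma terms_eval_comb op v p :
  terms_eval (terms_comb op r v p) =
    \sum_(k < r) terms_eval (op k (nth gauss0 v k) p).
Proof.
rewrite /terms_comb -(big_mkord xpredT
  (fun k => terms_eval (op k (nth gauss0 v k) p))) /index_iota subn0.
elim: (iota 0 r) => [|k s IHs] /=; first by rewrite /terms_eval !big_nil.
by rewrite terms_eval_add IHs big_cons.
Qed.

Lemma terms_eval_linear_form v p :
  terms_eval (terms_comb terms_mulX r v p) =
    linear_form (gauss_row v) * terms_eval p.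
Proof.
rewrite terms_eval_comb /linear_form mulr_suml; apply: eq_bigr => k _.
by rewrite terms_eval_mulX mxE.
Qed.

Lemma terms_eval_dir_deriv v p :
  terms_eval (terms_comb terms_deriv r v p) =
    dir_deriv (gauss_row v) (terms_eval p).
Proof.
rewrite terms_eval_comb; apply: eq_bigr => k _.
by rewrite terms_eval_deriv mxE.
Qed.

Lemma terms_eval_const c : terms_eval [:: (nseq r 0%N, c)] = (phi c)%:MP.
Proof.
have monom0 : monom (nseq r 0%N) = 0%MM.
  by apply/mnmP => i; rewrite !mnmE nth_nseq if_same.
by rewrite /terms_eval big_seq1 monom0 mpolyX0 alg_mpolyC.
Qed.

(** * Gram matrices of Gaussian integer vectors *)

Definition gauss_mx n (V : seq (seq gauss)) : 'M[R[i]]_(n, r) :=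
  \matrix_(i < n, k < r) phi (nth gauss0 (nth [::] V i) k).

Definition gram n (V : seq (seq gauss)) : 'M[R[i]]_n :=
  gauss_mx n V *m (gauss_mx n V)^t*.

Lemma row_gauss_mx n V (i : 'I_n) :
  row i (gauss_mx n V) = gauss_row (nth [::] V i).
Proof. by apply/rowP => k; rewrite !mxE. Qed.

Lemma gram_entry n V (i j : 'I_n) :
  gram n V i j = phi (gauss_dot r (nth [::] V i) (nth [::] V j)).
Proof.
rewrite mxE /gauss_dot.
under eq_bigr => k _ do
  rewrite !mxE -complex_of_gauss_conj -complex_of_gaussM.
rewrite -(big_mkord xpredT (fun k => phi (gauss_mul
  (nth gauss0 (nth [::] V i) k) (gauss_conj (nth gauss0 (nth [::] V j) k))))).
rewrite /index_iota subn0.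
elim: (iota 0 r) => [|k s IHs] /=; first by rewrite big_nil.
by rewrite complex_of_gaussD -IHs big_cons.
Qed.

Lemma gram_psd n V : psd_hermitian (gram n V).
Proof.
rewrite /gram; set X := gauss_mx n V; split.
  apply/is_hermitianmxP; rewrite expr0 scale1r.
  apply/matrixP => i j; rewrite !mxE rmorph_sum; apply: eq_bigr => k _.
  by rewrite !mxE rmorphM /= conjCK mulrC.
move=> x; pose y := X^t* *m x.
have yX : y^t* = x^t* *m X.
  apply/matrixP => i j; rewrite !mxE rmorph_sum; apply: eq_bigr => k _.
  by rewrite !mxE rmorphM /= conjCK mulrC.
rewrite !mulmxA -yX -mulmxA -/y.
by rewrite mxE sumr_ge0 // => k _; rewrite !mxE mulrC; apply: mul_conjC_ge0.
Qed.

Lemma gram_ge0 n V :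
  size V = n -> all (fun u => all (fun v => gauss_ge0 (gauss_dot r u v)) V) V ->
  forall i j : 'I_n, 0 <= gram n V i j.
Proof.
move=> <- /allP Vge0 i j; rewrite gram_entry; apply: complex_of_gauss_ge0.
by apply: (allP (Vge0 _ _)); apply: mem_nth.
Qed.

Lemma gram_diag n V :
  size V = n ->
  \prod_(i < n) gram n V i i =
    phi (foldr gauss_mul gauss1 [seq gauss_dot r v v | v <- V]).
Proof.
move=> <-; under eq_bigr => i _ do rewrite gram_entry.
rewrite -(big_mkord xpredT
  (fun i => phi (gauss_dot r (nth [::] V i) (nth [::] V i)))).
rewrite -(big_nth [::] xpredT (fun v => phi (gauss_dot r v v))) /=.
elim: V => [|v V IHV] /=; first by rewrite big_nil complex_of_gauss1.
by rewrite big_cons IHV complex_of_gaussM.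
Qed.

Lemma gram_perE n V c :
  size V = n -> gram_per r V = [:: (nseq r 0%N, c)] -> per (gram n V) = phi c.
Proof.
move=> <- perV; apply: (can_inj (@mpolyCK r _)).
rewrite -terms_eval_const -perV /gram_per /gram.
set W := map_mx Num.conj (gauss_mx (size V) V).
have -> : (gauss_mx (size V) V)^t* = W^T by rewrite /W map_trmx.
rewrite -per_dir_deriv.
have -> : [seq row i (gauss_mx (size V) V) | i <- enum 'I_(size V)] =
          map gauss_row V.
  rewrite -[in RHS](mkseq_nth [::] V) /mkseq -val_enum_ord -!map_comp.
  by apply: eq_map => i /=; rewrite row_gauss_mx.
have -> : \prod_j linear_form (row j W) =
    terms_eval (foldr (terms_comb terms_mulX r) [:: (nseq r 0%N, gauss1)]
           [seq map gauss_conj v | v <- V]).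
  under eq_bigr => j _.
    have -> : row j W = gauss_row (map gauss_conj (nth [::] V j)).
      apply/rowP => k; rewrite !mxE -complex_of_gauss_conj.
      have [kV|Vk] := ltnP k (size (nth [::] V j)).
        by rewrite (nth_map gauss0).
      by rewrite (nth_default _ Vk) nth_default ?size_map.
    over.
  rewrite -(big_mkord xpredT
    (fun j => linear_form (gauss_row (map gauss_conj (nth [::] V j))))).
  rewrite -(big_nth [::] xpredT
    (fun v => linear_form (gauss_row (map gauss_conj v)))) /=.
  elim: V {perV W} => [|v V IHV] /=.
    by rewrite big_nil terms_eval_const complex_of_gauss1.
  by rewrite big_cons terms_eval_linear_form IHV.
elim: V (foldr _ _ _) {perV W} => //= v V IHV p.
by rewrite -IHV terms_eval_dir_deriv.
Qed.

End Evaluation.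

Definition tensor2 (u v : seq gauss) : seq gauss :=
  let u_ := nth gauss0 u in let v_ := nth gauss0 v in
  [:: gauss_mul (u_ 0%N) (v_ 0%N); gauss_mul (u_ 0%N) (v_ 1%N);
      gauss_mul (u_ 1%N) (v_ 0%N); gauss_mul (u_ 1%N) (v_ 1%N)].

(** Inner products multiply under tensor products: the inner product of
    u (x) u' and v (x) v' is that of u, v times that of u', v'. *)
Lemma hadamard_gram (R : realType) n U V :
  size U = n -> size V = n ->
  hadamard (gram R 2 n U) (gram R 2 n V) =
    gram R 4 n [seq tensor2 p.1 p.2 | p <- zip U V].
Proof.
move=> sU sV; apply/matrixP => i j; rewrite mxE !gram_entry.
rewrite !(nth_map ([::], [::])) ?nth_zip ?size_zip ?sU ?sV ?minnn //=.
rewrite /gauss_dot /= !complex_of_gaussD !complex_of_gaussM.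
rewrite !complex_of_gauss_conj !complex_of_gaussM !rmorphM /= complex_of_gauss0.
ring.
Qed.

(** * The two matrices *)

Local Open Scope Z_scope.

Definition vectorsA : seq (seq gauss) :=
  [:: [:: (1, 0); (0, 0)];   [:: (1, 0); (0, 0)];   [:: (1, 0); (0, 0)];
      [:: (0, 0); (1, 0)];   [:: (0, 0); (1, 0)];   [:: (0, 0); (1, 0)];
      [:: (1, 1); (-1, 0)];  [:: (1, 1); (-1, 0)];
      [:: (1, 0); (-1, -1)]; [:: (1, 0); (-1, -1)];
      [:: (1, 1); (0, 1)];   [:: (1, 0); (1, -1)];
      [:: (1, 0); (0, 1)];   [:: (1, 0); (0, -1)];
      [:: (1, 0); (1, 0)];   [:: (1, 1); (1, 0)]].

Definition vectorsB : seq (seq gauss) :=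
  [seq [:: (3, 0); (x, 0)]
     | x <- [:: -1; -1; -1; 3; 3; 3; -3; -3; 2; 2; -1; 1; -3; 1; 0; 0]].

Definition vectorsAB : seq (seq gauss) :=
  [seq tensor2 p.1 p.2 | p <- zip vectorsA vectorsB].

Lemma gram_per_A :
  gram_per 2 vectorsA = [:: (nseq 2 0%N, (2453939712000, 0))].
Proof. by vm_compute. Qed.

Lemma gram_per_AB :
  gram_per 4 vectorsAB =
    [:: (nseq 4 0%N, (1261195342228823138813713121280, 0))].
Proof. by vm_compute. Qed.

Lemma diag_B :
  foldr gauss_mul gauss1 [seq gauss_dot 2 v v | v <- vectorsB] =
    (465593334336000000, 0).
Proof. by vm_compute. Qed.

Local Close Scope Z_scope.

Theorem corollary3 (R : realType) :
  exists (n : nat) (A B : 'M[R[i]]_n),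
    (1 <= n)%N /\
    psd_hermitian A /\
    psd_hermitian B /\
    (forall i j : 'I_n, 0 <= B i j) /\
    per A * \prod_(i < n) B i i < per (hadamard A B).
Proof.
exists 16, (gram R 2 16 vectorsA), (gram R 2 16 vectorsB).
split=> //; split; first exact: gram_psd.
split; first exact: gram_psd.
split; first by apply: gram_ge0 => //; vm_compute.
rewrite (hadamard_gram R (n := 16)) // (gram_diag R 2 (n := 16)) // diag_B.
rewrite (gram_perE R (n := 16) _ gram_per_A) //.
rewrite (gram_perE R (n := 16) _ gram_per_AB) // -complex_of_gaussM.
exact: complex_of_gauss_lt.
Qed.
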